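(* Let $c>0$, $\sigma>0$, $g\in C^2([0,\infty))$, $h\in C^1([0,\infty))$, $f\in C^1([0,\infty))$, and let $u: D^+\cup D^-\to\mathbb{R}$ be the solution (given by the explicit formula in the context) of the Robin problem $$u_{tt}-c^2u_{xx}=0\ (x>0,t>0),\quad u(x,0)=g(x),\ u_t(x,0)=h(x)\ (x>0),\quad u_x(0,t)+\sigma u(0,t)=f(t)\ (t>0).$$ Then $u$ is continuous across the characteristic line $t=x/c$, without any compatibility condition on the initial and boundary data.
   Context: Domains: $D^+=\{(x,t): x>0,\ t>0,\ x>ct\}$ and $D^-=\{(x,t): t>0,\ 0<x<ct\}$, separated by the characteristic line $x=ct$. Put $\phi(y)=\tfrac12 g(y)+\tfrac1{2c}\int_0^y h(\xi)\,d\xi$ for $y\ge0$. The solution of the Robin problem means the function obtained from d'Alembert's formula: $$u(x,t)=\tfrac12[g(x+ct)+g(x-ct)]+\tfrac1{2c}\int_{x-ct}^{x+ct}h(\xi)\,d\xi,\quad (x,t)\in D^+,$$ $$u(x,t)=\tfrac12[g(x+ct)+g(ct-x)]+\tfrac1{2c}\Big[\int_0^{x+ct}h(\xi)\,d\xi+\int_0^{ct-x}h(\xi)\,d\xi\Big]+e^{\sigma(ct-x)}\int_0^{x-ct}e^{\sigma\xi}f(-\xi/c)\,d\xi-2\sigma e^{\sigma(ct-x)}\int_0^{x-ct}e^{\sigma\xi}\phi(-\xi)\,d\xi,\quad (x,t)\in D^-.$$ For a function $w$ on $D^+\cup D^-$, the jump at a point $(x_0,x_0/c)$, $x_0>0$,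 is $[w]_{t=x/c}=\lim_{D^-\ni(x,t)\to(x_0,x_0/c)}w(x,t)-\lim_{D^+\ni(x,t)\to(x_0,x_0/c)}w(x,t)$ (both limits existing). $w$ is continuous across the line if this jump is zero at every such point. *)

(* Defs.v *)
From Stdlib Require Import Reals.
From Coquelicot Require Import Coquelicot.

Open Scope R_scope.

Definition half_line (x : R) : Prop := 0 <= x.

(** [is_derive] with the neighbourhood filter traced on [D]; at an endpoint
    of an interval [D] this is the one-sided derivative. *)
Definition is_derive_within (D : R -> Prop) (f : R -> R) (x l : R) : Prop :=
  filterdiff f (within D (locally x)) (fun y => scal y l).

(** Functions on [D] are represented by total functions, whose values
    outside [D] are irrelevant. *)
Fixpoint class_C (k : nat) (D : R -> Prop) (f : R -> R) : Prop :=
  match k with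
  | O => continuous_on D f
  | S k' => exists f' : R -> R,
      (forall x, D x -> is_derive_within D f x (f' x)) /\ class_C k' D f'
  end.

Definition Dplus (c : R) (p : R * R) : Prop :=
  0 < fst p /\ 0 < snd p /\ c * snd p < fst p.

Definition Dminus (c : R) (p : R * R) : Prop :=
  0 < snd p /\ 0 < fst p /\ fst p < c * snd p.

Definition phi (c : R) (g h : R -> R) (y : R) : R :=
  / 2 * g y + / (2 * c) * RInt h 0 y.

Definition dalembert_plus (c : R) (g h : R -> R) (x t : R) : R :=
  / 2 * (g (x + c * t) + g (x - c * t))
  + / (2 * c) * RInt h (x - c * t) (x + c * t).

(** In the last two terms the upper bound [x - c * t] is negative on
    [Dminus c]; [RInt] is the oriented integral. *)
Definition dalembert_minus (c sigma : R) (g h f : R -> R) (x t : R) : R :=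
  / 2 * (g (x + c * t) + g (c * t - x))
  + / (2 * c) * (RInt h 0 (x + c * t) + RInt h 0 (c * t - x))
  + exp (sigma * (c * t - x))
    * RInt (fun xi => exp (sigma * xi) * f (- xi / c)) 0 (x - c * t)
  - 2 * sigma * exp (sigma * (c * t - x))
    * RInt (fun xi => exp (sigma * xi) * phi c g h (- xi)) 0 (x - c * t).

(** The solution of
      u_tt - c^2 u_xx = 0  (x > 0, t > 0),
      u(x,0) = g(x),  u_t(x,0) = h(x)  (x > 0),
      u_x(0,t) + sigma u(0,t) = f(t)  (t > 0)
    is by definition the function on [Dplus c] and [Dminus c] given by
    d'Alembert's formula; its values elsewhere are unconstrained. *)
Definition robin_solution (c sigma : R) (g h f : R -> R) (u : R * R -> R)
  : Prop :=
  (forall x t, Dplus c (x, t) -> u (x, t) = dalembert_plus c g h x t) /\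
  (forall x t, Dminus c (x, t) ->
     u (x, t) = dalembert_minus c sigma g h f x t).

Definition is_lim_within (D : R * R -> Prop) (w : R * R -> R) (p : R * R)
  (l : R) : Prop :=
  filterlim w (within D (locally p)) (locally l).

(** The jump of [w] at [(x0, x0 / c)] exists and equals [j]. *)
Definition is_jump (c : R) (w : R * R -> R) (x0 j : R) : Prop :=
  exists lminus lplus : R,
    is_lim_within (Dminus c) w (x0, x0 / c) lminus /\
    is_lim_within (Dplus c) w (x0, x0 / c) lplus /\
    j = lminus - lplus.

Definition continuous_across_characteristic (c : R) (w : R * R -> R) : Prop :=
  forall x0, 0 < x0 -> is_jump c w x0 0.

(* Main.v *)
From Stdlib Require Import Reals Lra.
From Coquelicot Require Import Coquelicot.
Require Import Defs.

Open Scope R_scope.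

(** As [(x, t)] tends to a point [(x0, x0 / c)] of the characteristic line,
    [x - c * t] tends to [0].  The formula on the side [c * t < x] then tends to
    [/ 2 * (g (2 * x0) + g 0) + / (2 * c) * RInt h 0 (2 * x0)].  On the other
    side, the two integrals that carry [f] and [phi] run from [0] to
    [x - c * t], so they vanish in the limit, and so does the integral of [h]
    from [0] to [c * t - x]: the same value remains, whatever the boundary
    datum [f] is.  No relation between [g 0], [h 0] and [f 0] enters.

    The data are only controlled on the half-line, while continuity statements
    are easiest for functions on the whole line.  Both formulas evaluate the
    data at nonnegative arguments only, so each datum may be replaced by its
    even reflection, which is continuous everywhere
    ([dalembert_plus_even_ext], [dalembert_minus_even_ext]).  With reflected
    data the two formulas are continuous on the whole plane
    ([continuous_dalembert_plus], [continuous_dalembert_minus]), hence each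
    one-sided limit is a value on the line, and the two values coincide
    ([dalembert_eq_on_characteristic]). *)

Lemma class_C_continuous_on (k : nat) (D : R -> Prop) (f : R -> R) :
  class_C k D f -> continuous_on D f.
Proof.
destruct k as [|k]; [easy|].
intros [f' [Hd _]] x Dx.
apply (filterdiff_continuous_aux (F := within D (locally x)) f).
- eexists; exact (Hd x Dx).
- exact (filter_le_within D).
Qed.

(** Reflection, rather than extension by a constant, lets continuity follow
    from that of [Rabs]; the choice of extension is otherwise immaterial. *)
Definition even_ext (f : R -> R) (x : R) : R := f (Rabs x).

Lemma even_ext_half_line (f : R -> R) (x : R) : 0 <= x -> even_ext f x = f x.
Proof. intros Hx; unfold even_ext; now rewrite Rabs_pos_eq. Qed.

Lemma continuous_even_ext (f : R -> R) :
  continuous_on half_line f -> forall x, continuous (even_ext f) x.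
Proof.
intros Hf x.
apply (filterlim_comp _ _ _ Rabs f _
         (within half_line (locally (Rabs x)))).
- intros P HP.
  generalize (continuous_Rabs x _ HP); unfold filtermap.
  apply filter_imp; intros y Hy; exact (Hy (Rabs_pos y)).
- exact (Hf _ (Rabs_pos x)).
Qed.

Lemma RInt_even_ext (h : R -> R) (a b : R) :
  0 <= a -> 0 <= b -> RInt (even_ext h) a b = RInt h a b.
Proof.
intros Ha Hb; apply RInt_ext; intros y [Hy _].
apply even_ext_half_line.
generalize (Rmin_glb _ _ _ Ha Hb); lra.
Qed.

Lemma phi_even_ext (c : R) (g h : R -> R) (y : R) :
  0 <= y -> phi c (even_ext g) (even_ext h) y = phi c g h y.
Proof.
intros Hy; unfold phi.
rewrite even_ext_half_line, RInt_even_ext; lra.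
Qed.

Lemma dalembert_plus_even_ext (c : R) (g h : R -> R) (x t : R) :
  0 < c -> Dplus c (x, t) ->
  dalembert_plus c (even_ext g) (even_ext h) x t = dalembert_plus c g h x t.
Proof.
unfold Dplus, dalembert_plus; simpl; intros Hc [Hx [Ht Hxt]].
assert (0 < c * t) by now apply Rmult_lt_0_compat.
rewrite !even_ext_half_line, RInt_even_ext; lra.
Qed.

Lemma dalembert_minus_even_ext (c sigma : R) (g h f : R -> R) (x t : R) :
  0 < c -> Dminus c (x, t) ->
  dalembert_minus c sigma (even_ext g) (even_ext h) (even_ext f) x t
  = dalembert_minus c sigma g h f x t.
Proof.
unfold Dminus, dalembert_minus; simpl; intros Hc [Ht [Hx Hxt]].
rewrite !even_ext_half_line, !RInt_even_ext by lra.
(* The upper bound [x - c * t] is negative, so the variable of integration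
   is negative and both integrands sample the data at positive points. *)
assert (Hneg : forall y, Rmin 0 (x - c * t) < y < Rmax 0 (x - c * t) -> y < 0).
{ intros y; rewrite Rmax_left by lra; lra. }
f_equal; [f_equal|]; f_equal; apply RInt_ext; intros y Hy;
  apply Hneg in Hy; f_equal.
- apply even_ext_half_line.
  apply Rlt_le, Rdiv_lt_0_compat; lra.
- apply phi_even_ext; lra.
Qed.

Lemma continuous_Ropp {U : UniformSpace} (F : U -> R) (p : U) :
  continuous F p -> continuous (fun q => - F q) p.
Proof. exact (continuous_opp F p). Qed.

Lemma continuous_Rplus {U : UniformSpace} (F G : U -> R) (p : U) :
  continuous F p -> continuous G p -> continuous (fun q => F q + G q) p.
Proof. exact (continuous_plus F G p). Qed.

Lemma continuous_Rminus {U : UniformSpace} (F G : U -> R) (p : U) :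
  continuous F p -> continuous G p -> continuous (fun q => F q - G q) p.
Proof. exact (continuous_minus F G p). Qed.

Lemma continuous_Rmult {U : UniformSpace} (F G : U -> R) (p : U) :
  continuous F p -> continuous G p -> continuous (fun q => F q * G q) p.
Proof. exact (continuous_mult F G p). Qed.

Lemma continuous_RInt_bounds {U : UniformSpace} (k : R -> R) (a b : U -> R)
  (p : U) :
  (forall y, continuous k y) -> continuous a p -> continuous b p ->
  continuous (fun q => RInt k (a q) (b q)) p.
Proof.
intros Hk Ha Hb.
apply (continuous_comp_2 a b (RInt k)); [exact Ha|exact Hb|].
apply (continuous_RInt k).
apply filter_forall; intros z.
apply (RInt_correct (V := R_CompleteNormedModule)), ex_RInt_continuous.
intros y _; apply Hk.
Qed.

(** Reduces continuity of an expression to continuity of the data, applied to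
    the functions [k] for which [Hk : forall y, continuous k y] is at hand. *)
Ltac prove_continuous :=
  first [ apply continuous_const | apply continuous_id
        | apply continuous_fst | apply continuous_snd |
  match goal with
  | |- continuous (fun q => _ + _) _ =>
      apply continuous_Rplus; prove_continuous
  | |- continuous (fun q => _ - _) _ =>
      apply continuous_Rminus; prove_continuous
  | |- continuous (fun q => _ * _) _ =>
      apply continuous_Rmult; prove_continuous
  | |- continuous (fun q => _ / _) _ =>
      apply continuous_Rmult; prove_continuous
  | |- continuous (fun q => - _) _ =>
      apply continuous_Ropp; prove_continuous
  | |- continuous (fun q => exp (@?F q)) _ =>
      apply (continuous_comp F exp); [prove_continuous|apply continuous_exp]
  | |- continuous (fun q => RInt _ _ _) _ =>
      apply continuous_RInt_bounds; [intros ?|..]; prove_continuous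
  (* Matching does not see through eta: these are the contracted forms of
     [fun q => RInt k a q] and [fun q => - q]. *)
  | |- continuous (RInt ?k ?a) _ =>
      apply (continuous_RInt_bounds k (fun _ => a) (fun q => q));
      [intros ?|..]; prove_continuous
  | |- continuous Ropp _ => apply (continuous_Ropp (fun q => q)), continuous_id
  | H : forall y, continuous ?k y |- continuous ?k _ => apply H
  | H : forall y, continuous ?k y |- continuous (fun q => ?k (@?F q)) _ =>
      apply (continuous_comp F k); [prove_continuous|apply H]
  end ].

Lemma continuous_phi (c : R) (g h : R -> R) :
  (forall y, continuous g y) -> (forall y, continuous h y) ->
  forall y, continuous (phi c g h) y.
Proof. intros Hg Hh y; unfold phi; prove_continuous. Qed.

Lemma continuous_dalembert_plus (c : R) (g h : R -> R) (x t : R) :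
  (forall y, continuous g y) -> (forall y, continuous h y) ->
  continuous (fun p : R * R => dalembert_plus c g h (fst p) (snd p)) (x, t).
Proof. intros Hg Hh; unfold dalembert_plus; prove_continuous. Qed.

Lemma continuous_dalembert_minus (c sigma : R) (g h f : R -> R) (x t : R) :
  (forall y, continuous g y) -> (forall y, continuous h y) ->
  (forall y, continuous f y) ->
  continuous (fun p : R * R =>
    dalembert_minus c sigma g h f (fst p) (snd p)) (x, t).
Proof.
intros Hg Hh Hf; unfold dalembert_minus.
generalize (continuous_phi c g h Hg Hh); intros Hphi.
prove_continuous.
Qed.

(** On the line [x = c * t] every integral up to [x - c * t] or [c * t - x]
    is over a degenerate interval. *)
Lemma dalembert_eq_on_characteristic (c sigma : R) (g h f : R -> R) (x t : R) :
  x = c * t ->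
  dalembert_minus c sigma g h f x t = dalembert_plus c g h x t.
Proof.
intros ->; unfold dalembert_minus, dalembert_plus.
rewrite !Rminus_diag, !RInt_point.
unfold zero; simpl; ring.
Qed.

(** A one-sided limit may be read off any function that agrees with [w] on
    the given side and is continuous at the point itself. *)
Lemma is_lim_within_continuous (D : R * R -> Prop) (w v : R * R -> R)
  (p : R * R) :
  (forall q, D q -> w q = v q) -> continuous v p -> is_lim_within D w p (v p).
Proof.
intros Hwv Hv.
apply (filterlim_within_ext D v); [intros q Dq; now rewrite Hwv|].
exact (filterlim_filter_le_1 v (filter_le_within D) Hv).
Qed.

Theorem proposition5 (c sigma : R) (g h f : R -> R) (u : R * R -> R)
  (hc : 0 < c) (hsigma : 0 < sigma)
  (hg : class_C 2 half_line g) (hh : class_C 1 half_line h)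
  (hf : class_C 1 half_line f)
  (hu : robin_solution c sigma g h f u) :
  continuous_across_characteristic c u.
Proof.
destruct hu as [Hplus Hminus].
apply class_C_continuous_on in hg, hh, hf.
generalize (continuous_even_ext g hg) (continuous_even_ext h hh)
  (continuous_even_ext f hf); intros Hg Hh Hf.
intros x0 _.
exists (dalembert_minus c sigma (even_ext g) (even_ext h) (even_ext f)
          x0 (x0 / c)),
       (dalembert_plus c (even_ext g) (even_ext h) x0 (x0 / c)).
split; [|split].
- apply (is_lim_within_continuous (Dminus c) u (fun p => dalembert_minus c sigma
           (even_ext g) (even_ext h) (even_ext f) (fst p) (snd p))).
  + intros [x t] Hp; simpl.
    rewrite dalembert_minus_even_ext by assumption; now apply Hminus.
  + now apply continuous_dalembert_minus.
- apply (is_lim_within_continuous (Dplus c) u (fun p => dalembert_plus c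
           (even_ext g) (even_ext h) (fst p) (snd p))).
  + intros [x t] Hp; simpl.
    rewrite dalembert_plus_even_ext by assumption; now apply Hplus.
  + now apply continuous_dalembert_plus.
- rewrite dalembert_eq_on_characteristic; [ring|field; lra].
Qed.
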